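(* Let $R$ be a commutative ring and let $\mathcal{Q}$ be a PMQ. Let the enveloping group $\mathcal{G}(\mathcal{Q})$ act on the PMQ-ring $R[\mathcal{Q}]$ by conjugation, i.e. by $R$-algebra automorphisms induced from the adjoint action of $\mathcal{G}(\mathcal{Q})$ on $\mathcal{Q}$. Then the subring $\mathcal{A}(\mathcal{Q})=R[\mathcal{Q}]^{\mathcal{G}(\mathcal{Q})}\subseteq R[\mathcal{Q}]$ of conjugation-invariant elements is a commutative ring.
   Context: A quandle (with unit) is a set $\mathcal{Q}$ with an element $\mathbf{1}\in\mathcal{Q}$ (unit) and a binary operation $(a,b)\mapsto a^b$ (conjugation) such that: $(-)^a\colon\mathcal{Q}\to\mathcal{Q}$ is bijective for all $a$; $\mathbf{1}^a=\mathbf{1}$ and $a^{\mathbf{1}}=a$; $a^a=a$; $(a^b)^c=(a^c)^{(b^c)}$ for all $a,b,c$. A partial monoid is a set $M$ with an element $\mathbf{1}$, a subset $D\subseteq M\times M$ and a map $D\to M$, $(a,b)\mapsto ab$ (one says $ab$ is defined if $(a,b)\in D$), such that $\mathbf{1}a$ and $a\mathbf{1}$ are defined and equal to $a$, and for all $a,b,c$: ($ab$ and $(ab)c$ are defined) if and only if ($bc$ and $a(bc)$ are defined), in which case $(ab)c=a(bc)$. A PMQ is a set $\mathcal{Q}$ that is both a quandle and a partial monoid with the same unit, such that for all $a,b,c$: (1) $ab$ is defined iff $b(a^b)$ is defined, and then $ab=b(a^b)$; (2) $a^{(bc)}=(a^b)^c$ whenever $bc$ is defined; (3) $ab$ is defined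 iff $(a^c)(b^c)$ is defined, and then $(ab)^c=(a^c)(b^c)$. The enveloping group $\mathcal{G}(\mathcal{Q})$ has generators $[a]$, $a\in\mathcal{Q}$, and relations $[b]^{-1}[a][b]=[a^b]$ for all $a,b$, and $[a][b]=[ab]$ whenever $ab$ is defined. The adjoint action is the right action of $\mathcal{G}(\mathcal{Q})$ on $\mathcal{Q}$ by PMQ automorphisms for which $[b]$ acts by $a\mapsto a^b$. The PMQ-ring $R[\mathcal{Q}]$ is the associative $R$-algebra that is free as an $R$-module on basis elements indexed by $\mathcal{Q}$ (the basis element of $a$ being written $\langle a\rangle$), with $\langle a\rangle\langle b\rangle=\langle ab\rangle$ if $ab$ is defined in $\mathcal{Q}$ and $\langle a\rangle\langle b\rangle=0$ otherwise. *)

(* Defs.v *)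
From HB Require Import structures.
From mathcomp Require Import all_boot all_order all_algebra.
From mathcomp Require Import finmap generic_quotient boolp.
From mathcomp Require Import monalg.

Set Implicit Arguments.
Unset Strict Implicit.
Unset Printing Implicit Defensive.

Import GRing.Theory.

Declare Scope pmq_scope.
Delimit Scope pmq_scope with pmq.

HB.mixin Record hasQUnit T of Choice T := { qunit : T }.

HB.structure Definition UnitalSet := { T of Choice T & hasQUnit T }.

(* [qconj a b] is a^b. *)
HB.mixin Record isQuandle T of UnitalSet T := {
  qconj : T -> T -> T;
  qconj_bij : forall a, bijective (fun x => qconj x a);
  qconj1l : forall a, qconj qunit a = qunit;
  qconj1r : forall a, qconj a qunit = a;
  qconjxx : forall a, qconj a a = a;
  qconjJ : forall a b c,
    qconj (qconj a b) c = qconj (qconj a c) (qconj b c)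
}.

#[short(type="quandleType")]
HB.structure Definition Quandle := { T of UnitalSet T & isQuandle T }.

(* The partial product is option-valued: ab is defined iff [pmul a b] is not
   [None], so an equality between options says that one side is defined iff the
   other is, and that the values then agree. *)
HB.mixin Record isPartialMonoid T of UnitalSet T := {
  pmul : T -> T -> option T;
  pmul1l : forall a, pmul qunit a = Some a;
  pmul1r : forall a, pmul a qunit = Some a;
  pmulA : forall a b c,
    obind (fun ab => pmul ab c) (pmul a b) =
    obind (fun bc => pmul a bc) (pmul b c)
}.

#[short(type="partialMonoidType")]
HB.structure Definition PartialMonoid :=
  { T of UnitalSet T & isPartialMonoid T }.

HB.mixin Record isPMQ T of Quandle T & PartialMonoid T := {
  pmulJ : forall a b : T, pmul a b = pmul b (qconj a b);
  qconjM : forall a b c bc : T,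
    pmul b c = Some bc -> qconj a bc = qconj (qconj a b) c;
  qconj_pmul : forall a b c : T,
    omap (fun ab => qconj ab c) (pmul a b) = pmul (qconj a c) (qconj b c)
}.

#[short(type="pmqType")]
HB.structure Definition PMQ :=
  { T of Quandle T & PartialMonoid T & isPMQ T }.

Notation "a ^^ b" := (qconj a b)
  (at level 30, right associativity) : pmq_scope.

Section QuandleTheory.
Context {Q : quandleType}.
Local Open Scope pmq_scope.

Lemma qconj_surj (b y : Q) : exists x, x ^^ b == y.
Proof. by case: (qconj_bij b) => h _ hK; exists (h y); rewrite hK. Qed.

Definition qconjV (y b : Q) : Q := xchoose (qconj_surj b y).

Lemma qconjVK b : cancel (fun y : Q => qconjV y b) (fun x => x ^^ b).
Proof. by move=> y; apply/eqP/(xchooseP (qconj_surj b y)). Qed.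

Lemma qconjK b : cancel (fun x : Q => x ^^ b) (fun y => qconjV y b).
Proof. by move=> x; apply: (bij_inj (qconj_bij b)); rewrite qconjVK. Qed.

End QuandleTheory.

(* The enveloping group G(Q): words in the letters [a]^{+1} = (a, false) and
   [a]^{-1} = (a, true), modulo the congruence generated by the relations. *)

Section EnvelopingGroup.
Context (Q : pmqType).
Local Open Scope pmq_scope.

Definition env_word : Type := seq (Q * bool).

Inductive env_rel : env_word -> env_word -> Prop :=
| env_refl u : env_rel u u
| env_sym u v : env_rel u v -> env_rel v u
| env_trans u v w : env_rel u v -> env_rel v w -> env_rel u w
| env_cat u u' v v' :
    env_rel u u' -> env_rel v v' -> env_rel (u ++ v) (u' ++ v')
| env_mulVg a : env_rel [:: (a, true); (a, false)] [::]
| env_mulgV a : env_rel [:: (a, false); (a, true)] [::]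
| env_conj a b :
    env_rel [:: (b, true); (a, false); (b, false)] [:: (a ^^ b, false)]
| env_mul a b ab : pmul a b = Some ab ->
    env_rel [:: (a, false); (b, false)] [:: (ab, false)].

Definition env_relb : rel env_word := fun u v => `[< env_rel u v >].

Lemma env_relb_equiv : equiv_class_of env_relb.
Proof.
split=> [u|u v|v u w].
- exact/asboolP/env_refl.
- by apply/asboolP/asboolP; apply: env_sym.
- by move=> /asboolP uv /asboolP vw; apply/asboolP/(env_trans uv vw).
Qed.

Canonical env_equiv_rel := EquivRelPack env_relb_equiv.

Definition env_group : Type := {eq_quot env_equiv_rel}%qT.

HB.instance Definition _ := Choice.on env_group.
HB.instance Definition _ := EqQuotient.on env_group.

Definition env_class (w : env_word) : env_group := (\pi_env_group w)%qT.

Lemma env_classP u v : env_class u = env_class v <-> env_rel u v.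
Proof. by split=> [/eqmodP/asboolP|?] //; apply/eqmodP/asboolP. Qed.

Lemma env_classK g : env_class (repr g) = g.
Proof. exact: reprK. Qed.

Lemma env_repr u : env_rel (repr (env_class u)) u.
Proof. by apply/env_classP; rewrite env_classK. Qed.

Definition env_word_inv (w : env_word) : env_word :=
  rev [seq (l.1, ~~ l.2) | l <- w].

Lemma env_word_mulVg w : env_rel (env_word_inv w ++ w) [::].
Proof.
elim: w => [|[a e] w IH]; first exact: env_refl.
rewrite /env_word_inv /= rev_cons -cats1 -catA.
apply: env_trans IH; apply: env_cat; first exact: env_refl.
apply: (@env_cat [:: (a, ~~ e); (a, e)] [::] w w) (env_refl _).
by case: e; [apply: env_mulgV|apply: env_mulVg].
Qed.

Lemma env_word_invK : involutive env_word_inv.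
Proof.
move=> w; rewrite /env_word_inv map_rev revK -map_comp.
by rewrite -[RHS]map_id; apply: eq_map => -[a []].
Qed.

Lemma env_word_mulgV w : env_rel (w ++ env_word_inv w) [::].
Proof. by rewrite -{1}[w]env_word_invK; apply: env_word_mulVg. Qed.

Definition env_one : env_group := env_class [::].
Definition env_prod (g h : env_group) : env_group :=
  env_class (repr g ++ repr h).
Definition env_inv (g : env_group) : env_group :=
  env_class (env_word_inv (repr g)).

Lemma env_prodE u v :
  env_prod (env_class u) (env_class v) = env_class (u ++ v).
Proof. by apply/env_classP/env_cat; apply: env_repr. Qed.

Lemma env_prodA : associative env_prod.
Proof.
move=> g h k; rewrite -[g]env_classK -[h]env_classK -[k]env_classK.
by rewrite !env_prodE catA.
Qed.

Lemma env_prod1g : left_id env_one env_prod.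
Proof. by move=> g; rewrite -[g]env_classK env_prodE. Qed.

Lemma env_prodg1 : right_id env_one env_prod.
Proof. by move=> g; rewrite -[g]env_classK env_prodE cats0. Qed.

Lemma env_prodVg : left_inverse env_one env_inv env_prod.
Proof.
move=> g; rewrite -[X in env_prod _ X]env_classK env_prodE.
exact/env_classP/env_word_mulVg.
Qed.

Lemma env_prodgV : right_inverse env_one env_inv env_prod.
Proof.
move=> g; rewrite -[X in env_prod X _]env_classK env_prodE.
exact/env_classP/env_word_mulgV.
Qed.

HB.instance Definition _ := isGroup.Build env_group
  env_prodA env_prod1g env_prodg1 env_prodVg env_prodgV.

Lemma env_classM u v : (env_class u * env_class v)%g = env_class (u ++ v).
Proof. exact: env_prodE. Qed.

Definition env_gen (a : Q) : env_group := env_class [:: (a, false)].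

Lemma env_genV a : (env_gen a)^-1%g = env_class [:: (a, true)].
Proof.
apply: (@mulgI _ (env_gen a)); rewrite mulgV.
by rewrite [RHS]env_classM; apply/env_classP/env_sym/env_mulgV.
Qed.

Lemma env_genJ a b :
  ((env_gen b)^-1 * env_gen a * env_gen b = env_gen (a ^^ b)%pmq)%g.
Proof.
rewrite env_genV (env_classM [:: (b, true)] [:: (a, false)]).
by rewrite (env_classM _ [:: (b, false)]); apply/env_classP/env_conj.
Qed.

Lemma env_genM a b ab :
  pmul a b = Some ab -> (env_gen a * env_gen b = env_gen ab)%g.
Proof. by move=> abE; rewrite [LHS]env_classM; apply/env_classP/env_mul. Qed.

Definition letter_act (x : Q) (l : Q * bool) : Q :=
  if l.2 then qconjV x l.1 else x ^^ l.1.

Definition adj_act (x : Q) (g : env_group) : Q := foldl letter_act x (repr g).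

Lemma foldl_letter_act u v : env_rel u v ->
  forall x, foldl letter_act x u = foldl letter_act x v.
Proof.
elim=> {u v} //= [u v w _ IH1 _ IH2|u u' v v' _ IH1 _ IH2|a|a|a b|a b ab abE] x.
- by rewrite IH1.
- by rewrite !foldl_cat IH1 IH2.
- exact: qconjVK.
- exact: qconjK.
- by rewrite /letter_act /= qconjJ qconjVK.
- by rewrite /letter_act /= (qconjM _ _ _ _ abE).
Qed.

Lemma adj_actE x w : adj_act x (env_class w) = foldl letter_act x w.
Proof. exact/foldl_letter_act/env_repr. Qed.

Lemma adj_act_gen x b : adj_act x (env_gen b) = x ^^ b.
Proof. exact: adj_actE. Qed.

Lemma adj_act1 x : adj_act x 1%g = x.
Proof. exact: adj_actE. Qed.

Lemma adj_actM x g h : adj_act x (g * h)%g = adj_act (adj_act x g) h.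
Proof. by rewrite adj_actE foldl_cat. Qed.

Lemma adj_actK g : cancel (adj_act^~ g) (adj_act^~ g^-1%g).
Proof. by move=> x; rewrite -adj_actM mulgV adj_act1. Qed.

Lemma adj_actVK g : cancel (adj_act^~ g^-1%g) (adj_act^~ g).
Proof. by move=> x; rewrite -adj_actM mulVg adj_act1. Qed.

Lemma letter_act_morph l :
  [/\ letter_act qunit l = qunit,
      forall x y, letter_act (x ^^ y) l = letter_act x l ^^ letter_act y l
    & forall x y, omap (letter_act^~ l) (pmul x y)
                  = pmul (letter_act x l) (letter_act y l)].
Proof.
case: l => c []; rewrite /letter_act /=; split=> [|x y|x y].
- by apply: (can_inj (qconjK c)); rewrite qconjVK qconj1l.
- by apply: (can_inj (qconjK c)); rewrite qconjVK qconjJ !qconjVK.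
- rewrite -{1}[x](qconjVK c) -{1}[y](qconjVK c) -qconj_pmul.
  by case: pmul => //= z; rewrite qconjK.
- exact: qconj1l.
- exact: qconjJ.
- exact: qconj_pmul.
Qed.

Lemma adj_act_unit g : adj_act qunit g = qunit.
Proof.
rewrite /adj_act; elim: (repr g : env_word) => //= l w IH.
by have [-> _ _] := letter_act_morph l.
Qed.

Lemma adj_act_qconj g x y : adj_act (x ^^ y) g = adj_act x g ^^ adj_act y g.
Proof.
rewrite /adj_act; elim: (repr g : env_word) x y => //= l w IH x y.
by have [_ -> _] := letter_act_morph l; rewrite IH.
Qed.

Lemma adj_act_pmul g x y :
  omap (adj_act^~ g) (pmul x y) = pmul (adj_act x g) (adj_act y g).
Proof.
rewrite /adj_act; elim: (repr g : env_word) x y => [|l w IH] x y /=.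
  by case: pmul.
by have [_ _ E] := letter_act_morph l; rewrite -IH -E; case: pmul.
Qed.

End EnvelopingGroup.

(* R[Q] as finitely supported functions Q -> R. The ring R may be zero, hence
   the [PzRing] structures; this also excludes the library's [lalgType], so
   compatibility with scaling is stated by separate lemmas. *)

Section PMQRing.
Context (R : comPzRingType) (Q : pmqType).
Local Open Scope ring_scope.

Definition pmq_ring : Type := {malg R[Q]}.

HB.instance Definition _ := GRing.Zmodule.on pmq_ring.

Implicit Types (x y z : pmq_ring) (a b c : Q) (r s : R).

Definition pmq_elt r a : pmq_ring := << r *g a >>.
Definition pmq_base a : pmq_ring := pmq_elt 1 a.

Definition pmq_elt_mul r a s b : pmq_ring :=
  if pmul a b is Some ab then pmq_elt (r * s) ab else 0.

Definition pmq_scale r x : pmq_ring :=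
  \sum_(a <- msupp x) pmq_elt (r * x@_a) a.

Definition pmq_mul x y : pmq_ring :=
  \sum_(a <- msupp x) \sum_(b <- msupp y) pmq_elt_mul (x@_a) a (y@_b) b.

Lemma pmq_eltD a : {morph pmq_elt^~ a : r s / r + s}.
Proof. exact: (raddfD (mkmalgU a)). Qed.

Lemma pmq_elt0 a : pmq_elt 0 a = 0.
Proof. exact: (raddf0 (mkmalgU a)). Qed.

Lemma pmq_supp (V : zmodType) (f : R -> Q -> V) x (d : {fset Q}) :
    (forall a, f 0 a = 0) -> (msupp x `<=` d)%fset ->
  \sum_(a <- msupp x) f (x@_a) a = \sum_(a <- d) f (x@_a) a.
Proof.
by move=> f0 sxd; apply: big_fset_incl => // a _ /mcoeff_outdom->.
Qed.

Lemma pmq_sumD (V : zmodType) (f : R -> Q -> V) :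
    (forall a, f 0 a = 0) -> (forall a, {morph f^~ a : r s / r + s}) ->
  {morph (fun x => \sum_(a <- msupp x) f (x@_a) a) : x y / x + y}.
Proof.
move=> f0 fD x y; pose d := (msupp x `|` msupp y)%fset.
rewrite (pmq_supp f0 (msuppD_le x y)) (pmq_supp f0 (fsubsetUl _ (msupp y))).
rewrite (pmq_supp f0 (fsubsetUr (msupp x) _)) -big_split /=.
by apply: eq_bigr => a _; rewrite mcoeffD fD.
Qed.

Lemma pmq_sumU (V : zmodType) (f : R -> Q -> V) r a :
    (forall a, f 0 a = 0) ->
  \sum_(b <- msupp (pmq_elt r a)) f ((pmq_elt r a)@_b) b = f r a.
Proof.
move=> f0; rewrite (pmq_supp f0 msuppU_le) big_seq_fset1.
by rewrite mcoeffUU.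
Qed.

Lemma pmq_ind (P : pmq_ring -> Prop) :
    P 0 -> (forall x y, P x -> P y -> P (x + y)) ->
  (forall r a, P (pmq_elt r a)) -> forall x, P x.
Proof.
move=> P0 PD PU x; rewrite [x](monalgE (x : {malg R[Q]})).
by apply: big_ind => // a _; apply: PU.
Qed.

Lemma pmq_elt_mul0l a s b : pmq_elt_mul 0 a s b = 0.
Proof. by rewrite /pmq_elt_mul; case: pmul => // c; rewrite mul0r pmq_elt0. Qed.

Lemma pmq_elt_mul0r r a b : pmq_elt_mul r a 0 b = 0.
Proof. by rewrite /pmq_elt_mul; case: pmul => // c; rewrite mulr0 pmq_elt0. Qed.

Lemma pmq_elt_mulDl a s b : {morph (fun r => pmq_elt_mul r a s b) : r t / r + t}.
Proof.
move=> r t; rewrite /pmq_elt_mul; case: pmul => [c|]; last by rewrite addr0.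
by rewrite mulrDl pmq_eltD.
Qed.

Lemma pmq_elt_mulDr r a b : {morph (fun s => pmq_elt_mul r a s b) : s t / s + t}.
Proof.
move=> s t; rewrite /pmq_elt_mul; case: pmul => [c|]; last by rewrite addr0.
by rewrite mulrDr pmq_eltD.
Qed.

Lemma pmq_mulDl : left_distributive pmq_mul +%R.
Proof.
move=> x y z; pose f r a := \sum_(b <- msupp z) pmq_elt_mul r a (z@_b) b.
apply: (@pmq_sumD _ f) => [a|a r s]; rewrite /f.
  by rewrite big1 // => b _; apply: pmq_elt_mul0l.
by rewrite -big_split; apply: eq_bigr => b _; apply: pmq_elt_mulDl.
Qed.

Lemma pmq_mulDr : right_distributive pmq_mul +%R.
Proof.
move=> x y z; rewrite /pmq_mul -big_split; apply: eq_bigr => a _ /=.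
apply: (@pmq_sumD _ (fun s b => pmq_elt_mul (x@_a) a s b)) => [b|b].
  exact: pmq_elt_mul0r.
exact: pmq_elt_mulDr.
Qed.

Lemma pmq_mul0l : left_zero 0 pmq_mul.
Proof. by move=> x; rewrite /pmq_mul msupp0 big_seq_fset0. Qed.

Lemma pmq_mul0r : right_zero 0 pmq_mul.
Proof.
by move=> x; rewrite /pmq_mul msupp0 big1 // => a _; rewrite big_seq_fset0.
Qed.

Lemma pmq_mulUU r a s b :
  pmq_mul (pmq_elt r a) (pmq_elt s b) = pmq_elt_mul r a s b.
Proof.
rewrite /pmq_mul.
rewrite (@pmq_sumU _ (fun r a => \sum_(b0 <- _) pmq_elt_mul r a _ b0)).
  by rewrite (@pmq_sumU _ (pmq_elt_mul r a)) // => c; apply: pmq_elt_mul0r.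
by move=> c; rewrite big1 // => d _; apply: pmq_elt_mul0l.
Qed.

Lemma pmq_mulA : associative pmq_mul.
Proof.
move=> x y z; elim/pmq_ind: x => [|x x' IH IH'|r a].
- by rewrite !pmq_mul0l.
- by rewrite !pmq_mulDl IH IH'.
elim/pmq_ind: y => [|y y' IH IH'|s b].
- by rewrite !(pmq_mul0l, pmq_mul0r).
- by rewrite !(pmq_mulDl, pmq_mulDr) IH IH'.
elim/pmq_ind: z => [|z z' IH IH'|t c].
- by rewrite !pmq_mul0r.
- by rewrite !pmq_mulDr IH IH'.
rewrite !pmq_mulUU /pmq_elt_mul; have := pmulA a b c.
case: (pmul a b) => [ab|]; case: (pmul b c) => [bc|] /=;
  rewrite ?pmq_mul0l ?pmq_mul0r ?pmq_mulUU // /pmq_elt_mul.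
- by move=> ->; rewrite mulrA.
- by move=> ->.
- by move=> <-.
Qed.

Lemma pmq_mul1l : left_id (pmq_base qunit) pmq_mul.
Proof.
elim/pmq_ind => [|x y IHx IHy|r a]; first exact: pmq_mul0r.
  by rewrite pmq_mulDr IHx IHy.
by rewrite pmq_mulUU /pmq_elt_mul pmul1l mul1r.
Qed.

Lemma pmq_mul1r : right_id (pmq_base qunit) pmq_mul.
Proof.
elim/pmq_ind => [|x y IHx IHy|r a]; first exact: pmq_mul0l.
  by rewrite pmq_mulDl IHx IHy.
by rewrite pmq_mulUU /pmq_elt_mul pmul1r mulr1.
Qed.

HB.instance Definition _ := GRing.Zmodule_isPzRing.Build pmq_ring
  pmq_mulA pmq_mul1l pmq_mul1r pmq_mulDl pmq_mulDr.

Lemma pmq_scaleE r x a : (pmq_scale r x)@_a = r * x@_a.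
Proof.
rewrite /pmq_scale raddf_sum /=.
rewrite (eq_bigr (fun b => r * (pmq_elt (x@_b) b)@_a)) => [|b _].
  by rewrite -mulr_sumr -raddf_sum; congr (_ * mcoeff a _); rewrite [RHS]monalgE.
by rewrite !mcoeffU mulrnAr.
Qed.

Lemma pmq_scaleA r s x : pmq_scale r (pmq_scale s x) = pmq_scale (r * s) x.
Proof. by apply/malgP=> a; rewrite !pmq_scaleE mulrA. Qed.

Lemma pmq_scale1 : left_id 1 pmq_scale.
Proof. by move=> x; apply/malgP=> a; rewrite pmq_scaleE mul1r. Qed.

Lemma pmq_scaleDr : right_distributive pmq_scale +%R.
Proof.
by move=> r x y; apply/malgP=> a; rewrite mcoeffD !pmq_scaleE mcoeffD mulrDr.
Qed.

Lemma pmq_scaleDl x : {morph pmq_scale^~ x : r s / r + s}.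
Proof. by move=> r s; apply/malgP=> a; rewrite mcoeffD !pmq_scaleE mulrDl. Qed.

HB.instance Definition _ := GRing.Zmodule_isLmodule.Build R pmq_ring
  pmq_scaleA pmq_scale1 pmq_scaleDr pmq_scaleDl.

Lemma pmq_scaleU r s a : r *: pmq_elt s a = pmq_elt (r * s) a.
Proof. by apply/malgP=> b; rewrite pmq_scaleE !mcoeffU mulrnAr. Qed.

Lemma pmq_scaleAl r x y : r *: (x * y) = (r *: x) * y.
Proof.
elim/pmq_ind: x => [|x x' IH IH'|s a].
- by rewrite scaler0 !mul0r scaler0.
- by rewrite mulrDl !scalerDr mulrDl IH IH'.
elim/pmq_ind: y => [|y y' IH IH'|t b].
- by rewrite !mulr0 scaler0.
- by rewrite !mulrDr !scalerDr IH IH'.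
rewrite pmq_scaleU; rewrite /GRing.mul /= !pmq_mulUU /pmq_elt_mul.
by case: pmul => [ab|]; rewrite ?scaler0 // pmq_scaleU mulrA.
Qed.

Lemma pmq_scaleAr r x y : r *: (x * y) = x * (r *: y).
Proof.
elim/pmq_ind: x => [|x x' IH IH'|s a].
- by rewrite !mul0r scaler0.
- by rewrite !mulrDl scalerDr IH IH'.
elim/pmq_ind: y => [|y y' IH IH'|t b].
- by rewrite scaler0 !mulr0 scaler0.
- by rewrite mulrDr !scalerDr mulrDr IH IH'.
rewrite pmq_scaleU; rewrite /GRing.mul /= !pmq_mulUU /pmq_elt_mul.
by case: pmul => [ab|]; rewrite ?scaler0 // pmq_scaleU mulrCA.
Qed.

Lemma pmq_baseE x : x = \sum_(a <- msupp x) x@_a *: pmq_base a.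
Proof.
rewrite {1}[x](monalgE (x : {malg R[Q]})); apply: eq_bigr => a _.
by rewrite pmq_scaleU mulr1.
Qed.

Lemma pmq_base1 : pmq_base qunit = 1.
Proof. by []. Qed.

Lemma pmq_baseM a b :
  pmq_base a * pmq_base b = if pmul a b is Some ab then pmq_base ab else 0.
Proof.
by rewrite [LHS]pmq_mulUU /pmq_elt_mul; case: pmul => // c; rewrite mulr1.
Qed.

(* The R-linear extension of the adjoint action; a right action. *)
Definition pmq_act (x : pmq_ring) (g : env_group Q) : pmq_ring :=
  \sum_(a <- msupp x) x@_a *: pmq_base (adj_act a g).

Lemma pmq_actD g : {morph pmq_act^~ g : x y / x + y}.
Proof.
apply: (@pmq_sumD _ (fun r a => r *: pmq_base (adj_act a g))) => [a|a r s].
  exact: scale0r.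
exact: scalerDl.
Qed.

Lemma pmq_actU g r a : pmq_act (pmq_elt r a) g = pmq_elt r (adj_act a g).
Proof.
rewrite /pmq_act (@pmq_sumU _ (fun r a => r *: pmq_base (adj_act a g))).
  by rewrite pmq_scaleU mulr1.
by move=> b; apply: scale0r.
Qed.

Lemma pmq_act_base g a : pmq_act (pmq_base a) g = pmq_base (adj_act a g).
Proof. exact: pmq_actU. Qed.

Lemma pmq_act0 g : pmq_act 0 g = 0.
Proof. by rewrite /pmq_act msupp0 big_seq_fset0. Qed.

Lemma pmq_actZ g r x : pmq_act (r *: x) g = r *: pmq_act x g.
Proof.
elim/pmq_ind: x => [|x y IHx IHy|s a].
- by rewrite scaler0 pmq_act0 scaler0.
- by rewrite scalerDr !pmq_actD scalerDr IHx IHy.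
- by rewrite pmq_scaleU !pmq_actU pmq_scaleU.
Qed.

Lemma pmq_act_one g : pmq_act 1 g = 1.
Proof. by rewrite -pmq_base1 pmq_act_base adj_act_unit. Qed.

Lemma pmq_act_mul g : {morph pmq_act^~ g : x y / x * y}.
Proof.
elim/pmq_ind => [|x x' IH IH'|r a] y.
- by rewrite mul0r pmq_act0 mul0r.
- by rewrite mulrDl !pmq_actD mulrDl IH IH'.
elim/pmq_ind: y => [|y y' IH IH'|s b].
- by rewrite mulr0 pmq_act0 mulr0.
- by rewrite mulrDr !pmq_actD mulrDr IH IH'.
rewrite !pmq_actU /GRing.mul /= !pmq_mulUU /pmq_elt_mul -adj_act_pmul.
by case: pmul => [ab|] /=; rewrite ?pmq_actU ?pmq_act0.
Qed.

Lemma pmq_act1 x : pmq_act x 1%g = x.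
Proof.
elim/pmq_ind: x => [|x y IHx IHy|s a]; first exact: pmq_act0.
  by rewrite pmq_actD IHx IHy.
by rewrite pmq_actU adj_act1.
Qed.

Lemma pmq_actM x g h : pmq_act x (g * h)%g = pmq_act (pmq_act x g) h.
Proof.
elim/pmq_ind: x => [|x y IHx IHy|s a]; first by rewrite !pmq_act0.
  by rewrite !pmq_actD IHx IHy.
by rewrite !pmq_actU adj_actM.
Qed.

Definition conj_invariant : {pred pmq_ring} :=
  fun x => `[< forall g : env_group Q, pmq_act x g = x >].

Lemma conj_invariantP x :
  reflect (forall g, pmq_act x g = x) (x \in conj_invariant).
Proof. exact: asboolP. Qed.

End PMQRing.

Arguments conj_invariant R Q : clear implicits.

(* Main.v *)
(** Since [ab = b(a^b)] in a PMQ, every [x] in [R[Q]] satisfies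
    [x * <b> = <b> * x^[b]], where [x^[b]] is the image of [x] under the
    generator [[b]] of the enveloping group. An invariant [x] therefore commutes
    with every [<b>], so invariant elements are even central in [R[Q]]. *)

Require Import Defs.
From mathcomp Require Import all_boot all_order all_algebra.

Import GRing.Theory.

Local Open Scope ring_scope.

(** [subring_closed] asks for closure under differences. *)
Lemma pmq_actB (R : comPzRingType) (Q : pmqType) (g : env_group Q) :
  {morph (fun x : pmq_ring R Q => pmq_act x g) : x y / x - y}.
Proof. by move=> x y; apply: (addIr (pmq_act y g)); rewrite -pmq_actD !subrK. Qed.

Lemma pmq_mul_elt (R : comPzRingType) (Q : pmqType) (x : pmq_ring R Q) s b :
  x * pmq_elt s b = pmq_elt s b * pmq_act x (env_gen b).
Proof.
elim/pmq_ind: x => [|x y IHx IHy|r a].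
- by rewrite pmq_act0 mul0r mulr0.
- by rewrite pmq_actD mulrDl mulrDr IHx IHy.
(* [pmulJ] equates options, so both products vanish together; where defined, they differ only in the
   order of the coefficients. *)
rewrite pmq_actU adj_act_gen /GRing.mul /= !pmq_mulUU /pmq_elt_mul -pmulJ.
by case: pmul => // ab; rewrite mulrC.
Qed.

(** Each [g] acts by a unital ring endomorphism, which fixes a subring. *)
Lemma conj_invariant_subring (R : comPzRingType) (Q : pmqType) :
  GRing.subring_closed (conj_invariant R Q).
Proof.
split=> [|x y /conj_invariantP xI /conj_invariantP yI
         |x y /conj_invariantP xI /conj_invariantP yI];
  apply/conj_invariantP => g.
- exact: pmq_act_one.
- by rewrite pmq_actB xI yI.
- by rewrite pmq_act_mul xI yI.
Qed.

Lemma conj_invariant_central (R : comPzRingType) (Q : pmqType)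
    (x y : pmq_ring R Q) : x \in conj_invariant R Q -> x * y = y * x.
Proof.
move=> /conj_invariantP xI; elim/pmq_ind: y => [|y z IHy IHz|s b].
- by rewrite mul0r mulr0.
- by rewrite mulrDl mulrDr IHy IHz.
(* Invariance at the generator [env_gen b] removes the twist. *)
- by rewrite pmq_mul_elt xI.
Qed.

Theorem lemma5 (R : comPzRingType) (Q : pmqType) :
  GRing.subring_closed (conj_invariant R Q) /\
  (forall x y : pmq_ring R Q,
     x \in conj_invariant R Q -> y \in conj_invariant R Q -> x * y = y * x).
Proof.
split; first exact: conj_invariant_subring.
by move=> x y xI _; apply: conj_invariant_central.
Qed.
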